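(* Every proper interval graph is a $50\%$ max-tolerance graph.
   Context: Graphs are finite and simple; intervals are closed bounded intervals of the real line, and $|I|$ denotes the length of an interval $I$. A proper interval graph is an interval graph (vertices assigned intervals, two distinct vertices adjacent if and only if their intervals intersect) having an interval representation in which no interval properly contains another. A graph $G=(V,E)$ is a $50\%$ max-tolerance graph if one can assign to each $u\in V$ an interval $I_u$ and a positive real tolerance $t_u$ with $t_u=|I_u|/2$ such that for distinct $u,v\in V$: $uv\in E$ if and only if $|I_u\cap I_v|\ge\max\{t_u,t_v\}$. *)

(* Defs.v *)
From mathcomp Require Import all_boot all_order all_algebra.
From mathcomp Require Import all_classical all_reals all_analysis.
Import Order.TTheory GRing.Theory Num.Theory.

Set Implicit Arguments.
Unset Strict Implicit.
Unset Printing Implicit Defensive.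

Local Open Scope classical_set_scope.
Local Open Scope ring_scope.

Record sgraph := SGraph {
  vertex :> finType;
  adj : rel vertex;
  adj_sym : symmetric adj;
  adj_irrefl : irreflexive adj
}.

(* Degenerate intervals [a, a] are allowed; the empty set is not an interval. *)
Record cinterval (R : realType) := CInterval {
  left_end : R;
  right_end : R;
  left_le_right : left_end <= right_end
}.

Definition points (R : realType) (I : cinterval R) : set R :=
  `[left_end I, right_end I]%classic.

(* Lebesgue measure, so that it applies to intersections of intervals, possibly
   empty.  [fine] is harmless: it is only applied to bounded sets. *)
Definition set_length (R : realType) (A : set R) : R :=
  fine (lebesgue_measure A).

Definition interval_representation (R : realType) (G : sgraph)
    (I : G -> cinterval R) : Prop :=
  forall u v : G, u != v ->
    (adj u v <-> points (I u) `&` points (I v) !=set0).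

(* [A `<` B] is strict inclusion, so distinct vertices may share an interval. *)
Definition proper_interval_graph (R : realType) (G : sgraph) : Prop :=
  exists2 I : G -> cinterval R, interval_representation I &
    forall u v : G, ~ (points (I u) `<` points (I v)).

Definition max_tolerance_representation (R : realType) (G : sgraph)
    (I : G -> cinterval R) (t : G -> R) : Prop :=
  (forall u : G, 0 < t u) /\
  (forall u v : G, u != v ->
    (adj u v <->
     Num.max (t u) (t v) <= set_length (points (I u) `&` points (I v)))).

Definition half_max_tolerance_graph (R : realType) (G : sgraph) : Prop :=
  exists (I : G -> cinterval R) (t : G -> R),
    max_tolerance_representation I t /\
    (forall u : G, t u = set_length (points (I u)) / 2).

(* Main.v *)
(** A proper interval graph is a unit interval graph: scanning the vertices by
    increasing midpoint, so that both endpoints are nondecreasing, one can place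
    the points [x u] one at a time such that adjacent vertices are at distance
    less than 1 and nonadjacent ones at distance more than 1.  The intervals
    [x u, x u + 2] with tolerance 1 then work, since two of them meet in length
    [2 - |x u - x v|] (or not at all). *)

Require Import Defs.
From mathcomp Require Import all_boot all_order all_algebra.
From mathcomp Require Import all_classical all_reals all_analysis.
From mathcomp Require Import lra.
Import Order.TTheory GRing.Theory Num.Theory.

Set Implicit Arguments.
Unset Strict Implicit.
Unset Printing Implicit Defensive.

Local Open Scope classical_set_scope.
Local Open Scope ring_scope.

Lemma seq_lower_bound (R : realFieldType) (B : seq R) :
  exists x, {in B, forall b, x < b}.
Proof.
elim: B => [|b B [x xB]]; first by exists 0.
exists (Num.min x (b - 1)) => c; rewrite inE => /predU1P[->|/xB xc];
  rewrite gt_min; apply/orP; [right; lra | by left].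
Qed.

Lemma seq_lower_bound_gt (R : realFieldType) (a : R) (B : seq R) :
  {in B, forall b, a < b} -> exists2 x, a < x & {in B, forall b, x < b}.
Proof.
elim: B => [|b B IH] aB; first by exists (a + 1); [lra|].
have [c cB|x ax xB] := IH; first by apply: aB; rewrite inE cB orbT.
have ab : a < b by apply: aB; rewrite mem_head.
exists (Num.min x ((a + b) / 2)); first by rewrite lt_min ax /=; lra.
move=> c; rewrite inE => /predU1P[->|/xB xc];
  rewrite gt_min; apply/orP; [right; lra | by left].
Qed.

(** This is the tool for placing one new point under finitely many strict constraints. Either list
    may be empty, so no maximum of [A] or minimum of [B] is taken. *)
Lemma seq_separation (R : realFieldType) (A B : seq R) :
  {in A & B, forall a b, a < b} ->
  exists2 x, {in A, forall a, a < x} & {in B, forall b, x < b}.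
Proof.
elim: A => [_|a A IH AB].
  by have [x xB] := seq_lower_bound B; exists x.
have [a' b aA bB|x Ax xB] := IH; first by apply: AB; rewrite ?inE ?aA ?orbT.
have [ax|xa] := ltP a x.
  by exists x => // a'; rewrite inE => /predU1P[->|/Ax].
(* Here [x <= a], so [a] exceeds the whole tail of [A], and it suffices to separate [a] alone from
   [B]. *)
have [b bB|y ay yB] := @seq_lower_bound_gt R a B.
  by apply: AB => //; rewrite mem_head.
exists y => // a'; rewrite inE => /predU1P[->//|/Ax a'x].
by rewrite (lt_trans a'x) // (le_lt_trans xa).
Qed.

(* The last condition is only there to make the induction go through. *)
Lemma unit_embedding (R : realFieldType) (T : eqType) (l r : T -> R) (s : seq T) :
  (forall u, l u <= r u) ->
  sorted (fun u v => (l v <= l u) && (r v <= r u)) s ->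
  exists x : T -> R, {in s &, forall u v,
    [/\ l v <= r u -> x v < x u + 1,
        r u < l v -> x u + 1 < x v &
        r u < r v -> x u < x v]}.
Proof.
move=> lr; set e := (fun u v => _).
have e_trans : transitive e.
  move=> v u w /andP[h1 h2] /andP[h3 h4].
  by rewrite /e (le_trans h3 h1) (le_trans h4 h2).
(* The list is decreasing, so its head [w] is the last vertex of the scan: the tail is embedded
   first and [w] goes to the right of it. *)
elim: s => [_|w s IH ws]; first by exists (fun=> 0).
have [x xP] := IH (path_sorted ws).
have sw u : u \in s -> l u <= l w /\ r u <= r w.
  by have /allP h := order_path_min e_trans ws; move=> /h /andP.
(* The position of [w] must lie above all of [A] and below all of [B]; the filters separate the
   intervals that miss that of [w] from those that meet it. *)
pose A := [seq x u | u <- s] ++ [seq x u + 1 | u <- s & r u < l w].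
pose B := [seq x u + 1 | u <- s & l w <= r u].
(* Compatibility: [l u <= l w <= r v] gives [x u < x v + 1], while [r u < l w <= r v] gives
   [x u < x v] by the third condition. *)
have [a b|y Ay yB] := @seq_separation R A B.
  rewrite mem_cat => /orP[] /mapP[u us ->{a}] /mapP[v];
    rewrite mem_filter => /andP[wv vs] ->{b}.
  - have [uw _] := sw _ us; have [+ _ _] := xP v u vs us.
    by apply; rewrite (le_trans uw).
  - move: us; rewrite mem_filter => /andP[uw us].
    have [_ _ /(_ (lt_le_trans uw wv))] := xP u v us vs; lra.
have xy u : u \in s -> x u < y.
  by move=> us; apply: Ay; rewrite mem_cat map_f.
have xy1 u : u \in s -> r u < l w -> x u + 1 < y.
  move=> us uw; apply: Ay; rewrite mem_cat; apply/orP; right.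
  by apply/mapP; exists u; rewrite // mem_filter uw.
have yx1 u : u \in s -> l w <= r u -> y < x u + 1.
  by move=> us uw; apply: yB; apply/mapP; exists u; rewrite // mem_filter uw.
have lrw := lr w.
exists (fun u => if u == w then y else x u) => u v.
rewrite !inE; case: (eqVneq u w) => [->|_] /=; case: (eqVneq v w) => [->|_] /=.
- by move=> _ _; split; lra.
(* The premises [r w < l v] and [r w < r v] are impossible, as [w] has the largest endpoints. *)
- move=> _ vs; have [lv rv] := sw _ vs; have := xy _ vs; have := lr v.
  by split; lra.
- by move=> us _; split=> *; [apply: yx1|apply: xy1|apply: xy].
- exact: xP.
Qed.

Lemma points_subset (R : realType) (I J : cinterval R) :
  left_end J <= left_end I -> right_end I <= right_end J ->
  points I `<=` points J.
Proof.
move=> lJI rIJ z; rewrite /points /= !in_itv /= => /andP[lz zr].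
by rewrite (le_trans lJI lz) (le_trans zr rIJ).
Qed.

Lemma points_proper (R : realType) (I J : cinterval R) :
  left_end J <= left_end I -> right_end I <= right_end J ->
  left_end J < left_end I \/ right_end I < right_end J ->
  points I `<` points J.
Proof.
move=> lJI rIJ lt_end; split; first exact: points_subset.
move=> JI; have lrJ := left_le_right J.
have : points I (left_end J) by apply: JI; rewrite /points /= in_itv /= lexx.
have : points I (right_end J).
  by apply: JI; rewrite /points /= in_itv /= lexx andbT.
rewrite /points /= !in_itv /= => /andP[_ h1] /andP[h2 _].
by case: lt_end; lra.
Qed.

Lemma points_meetP (R : realType) (I J : cinterval R) :
  points I `&` points J !=set0 <->
  left_end I <= right_end J /\ left_end J <= right_end I.
Proof.
have lrI := left_le_right I; have lrJ := left_le_right J.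
split=> [[z []]|[IJ JI]].
  by rewrite /points /= !in_itv /= => /andP[? ?] /andP[? ?]; split; lra.
exists (Num.max (left_end I) (left_end J)).
by split; rewrite /points /= in_itv /= le_max ge_max lexx ?orbT /=;
  apply/andP.
Qed.

(** The truncation at 0 covers [b < a], the empty interval, which arises when two disjoint intervals
    are intersected. *)
Lemma set_length_itvcc (R : realType) (a b : R) :
  set_length `[a, b] = Num.max 0 (b - a).
Proof.
rewrite /set_length lebesgue_measure_itv /= lte_fin.
by case: ltP => ab; [rewrite /= max_r|rewrite /= max_l] => //; lra.
Qed.

Lemma proper_interval_graph_unit (R : realType) (G : sgraph) :
  proper_interval_graph R G ->
  exists x : G -> R, forall u v, u != v -> adj u v <-> `|x u - x v| <= 1.
Proof.
move=> [I I_rep I_proper].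
pose l u := left_end (I u); pose r u := right_end (I u).
have lr u : l u <= r u by exact: left_le_right.
(* Midpoints up to a factor 2, in reverse, so that sorting yields a decreasing list. *)
pose m u v := l v + r v <= l u + r u.
have m_le u v : m u v -> (l v <= l u) && (r v <= r u).
  (* If the endpoints disagreed with the midpoints, one interval would lie strictly inside the
     other. *)
  move=> muv; have [lvu|luv] /= := leP (l v) (l u).
    rewrite leNgt; apply/negP => ruv; apply: (I_proper u v).
    by apply: points_proper => //; [exact: ltW|right].
  have rvu : r v <= r u by move: muv; rewrite /m; lra.
  by case: (I_proper v u (points_proper (ltW luv) rvu (or_introl luv))).
have s_sorted : sorted m (sort m (enum G)).
  by apply: sort_sorted => u v; exact: le_total.
have [x xP] := unit_embedding lr (sub_sorted m_le s_sorted).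
exists x => u v uv.
have sG w : w \in sort m (enum G) by rewrite mem_sort mem_enum.
have [vu_near vu_far _] := xP u v (sG u) (sG v).
have [uv_near uv_far _] := xP v u (sG v) (sG u).
rewrite (I_rep _ _ uv) points_meetP -/(l u) -/(l v) -/(r u) -/(r v) ler_norml.
split=> [[/uv_near h1 /vu_near h2]|/andP[h1 h2]]; first by apply/andP; lra.
by split; rewrite leNgt; apply/negP; [move/uv_far|move/vu_far]; lra.
Qed.

Theorem proposition4p4 (R : realType) (G : sgraph) :
  proper_interval_graph R G -> half_max_tolerance_graph R G.
Proof.
move=> /proper_interval_graph_unit[x xP].
have x2 u : x u <= x u + 2 by lra.
exists (fun u => CInterval (x2 u)), (fun=> 1); split; last first.
  by move=> u; rewrite /points /= set_length_itvcc max_r; lra.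
split=> // u v uv; rewrite maxxx /points /= (xP _ _ uv).
have -> : `[x u, x u + 2]%classic `&` `[x v, x v + 2]%classic =
    `[Num.max (x u) (x v), Num.min (x u + 2) (x v + 2)]%classic.
  apply/seteqP; split=> z /=; rewrite !in_itv /= ge_max le_min.
    by move=> [/andP[-> ->] /andP[-> ->]].
  by move=> /andP[/andP[-> ->] /andP[-> ->]].
(* Since the tolerance 1 exceeds 0, the truncated case drops out and only [max + 1 <= min] has to be
   compared with the distance. *)
rewrite set_length_itvcc le_max ler10 /= lerBrDr le_min ler_norml.
by case: (leP (x u) (x v)) => h; split=> /andP[h1 h2]; apply/andP; split; lra.
Qed.
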